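(* Let $r\ge 2$ be a fixed integer and let $C>0$ be a constant. Let $k=k_n$ satisfy $k\to\infty$ as $n\to\infty$ (i.e. $k=\omega(1)$) and $k\le C\sqrt n$. Let $\theta\in\{-1,0,1\}^n$ with $\|\theta\|_0=k$ be arbitrary, and let $S^0\in\{-1,0,1\}^n$ satisfy $\|S^0\|_0=\langle S^0,\theta\rangle=2$. Let $\lambda=\lambda_n$ satisfy $\lambda=\omega(k^{r/2}\sqrt{\log n})$ and observe $Y=\frac{\lambda}{k^{r/2}}\theta^{\otimes r}+W$, where $W\in(\mathbb R^{n})^{\otimes r}$ has i.i.d. $\mathcal N(0,1)$ entries. Then, if $\gamma=C_\gamma\sqrt{\log n}$ for some sufficiently large constant $C_\gamma=C_\gamma(r)>0$, the following event holds with probability at least $1-n^{-1/2}$ (over $W$ and the internal randomness of the second algorithm), for $n$ large: Greedy Local Search with input $(Y,S^0)$ outputs $\theta$ in $k-2$ iterations, and Randomized Greedy Local Search with input $(Y,S^0,M)$ for (a suitable) $M=\Theta(n\log n)$ outputs $\theta$.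
   Context: Notation: $\|v\|_0$ is the number of nonzero entries of $v$, $d_H$ is the Hamming distance (number of differing coordinates), $v^{\otimes r}$ is the $r$-fold tensor power, $\langle\cdot,\cdot\rangle$ is the entrywise inner product. Asymptotics are as $n\to\infty$ with $r$ fixed. Objective: $H_{r,\gamma}(\sigma)=\langle\sigma^{\otimes r},Y\rangle-\gamma\|\sigma\|_0^{r}$ for $\sigma\in\{-1,0,1\}^n$. Neighborhood: $\mathcal N(\sigma)=\{\sigma'\in\{-1,0,1\}^n: d_H(\sigma,\sigma')=1\}$. Greedy Local Search (input $Y,S^0$, parameter $\gamma$): for $t=0,1,2,\dots$, let $\sigma_{\rm loc}\in\arg\max_{\sigma\in\mathcal N(S^t)}H_{r,\gamma}(\sigma)$. If $H_{r,\gamma}(\sigma_{\rm loc})>H_{r,\gamma}(S^t)$ set $S^{t+1}=\sigma_{\rm loc}$; otherwise terminate and output $S^t$. Randomized Greedy Local Search (input $Y,S^0,M$, parameter $\gamma$): start at $S^0$ and perform $M$ iterations; in each iteration draw $\sigma'$ uniformly at random from $\mathcal N(S)$, where $S$ is the current state (independently of everything else), and replace $S$ by $\sigma'$ if $H_{r,\gamma}(\sigma')>H_{r,\gamma}(S)$, otherwise keep $S$. Output the final state. *)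

(* Defs.v *)
From HB Require Import structures.
From mathcomp Require Import all_boot all_order all_algebra.
From mathcomp Require Import all_classical all_reals all_analysis.
Set Implicit Arguments.
Unset Strict Implicit.
Unset Printing Implicit Defensive.
Import Order.TTheory GRing.Theory Num.Theory.
Import numFieldNormedType.Exports.
Local Open Scope classical_set_scope.
Local Open Scope ring_scope.

Definition spin : finType := seq_sub [:: -1 : int; 0; 1].

Definition config (n : nat) : finType := {ffun 'I_n -> spin}.

Definition vec {R : realType} {n : nat} (s : config n) : 'I_n -> R :=
  fun i => (ssval (s i))%:~R.

Definition dot {R : realType} {I : finType} (u v : I -> R) : R :=
  \sum_(i : I) u i * v i.

Definition norm0 {n : nat} (s : config n) : nat :=
  #|[set i : 'I_n | ssval (s i) != 0]%SET|.

Definition hamming {n : nat} (s s' : config n) : nat :=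
  #|[set i : 'I_n | s i != s' i]%SET|.

Definition neighborhood {n : nat} (s : config n) : {set config n} :=
  [set s' : config n | hamming s s' == 1%N]%SET.

(* Multi-indices (i_1, ..., i_r); elements of (R^n)^{(x) r} are represented
   by their entries, i.e. as functions on [midx r n]. *)
Definition midx (r n : nat) : finType := {ffun 'I_r -> 'I_n}.

Definition tpow {R : realType} {n : nat} (r : nat) (v : 'I_n -> R) :
    midx r n -> R :=
  fun a => \prod_(j < r) v (a j).
Arguments tpow {R n} r v a.

Definition objective {R : realType} {r n : nat} (gamma : R)
    (Y : midx r n -> R) (s : config n) : R :=
  dot (tpow r (vec s)) Y - gamma * (norm0 s)%:R ^+ r.

Definition observation {R : realType} {r n : nat} (lambda : R) (k : nat)
    (theta : config n) (W : midx r n -> R) : midx r n -> R :=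
  fun a => lambda / k%:R `^ (r%:R / 2) * tpow r (vec theta) a + W a.

Definition is_argmax {R : realType} {n : nat} (H : config n -> R)
    (s loc : config n) : Prop :=
  loc \in neighborhood s /\
  forall s', s' \in neighborhood s -> H s' <= H loc.

(* [greedy_output H s m out]: some run of greedy local search for H started at
   s terminates with output out after exactly m updates of the state.  Ties in
   the argmax may be broken arbitrarily at every step, so this is a relation. *)
Inductive greedy_output {R : realType} {n : nat} (H : config n -> R) :
    config n -> nat -> config n -> Prop :=
| greedy_stop s loc :
    is_argmax H s loc -> ~~ (H s < H loc) -> greedy_output H s 0 s
| greedy_step s loc m out :
    is_argmax H s loc -> H s < H loc ->
    greedy_output H loc m out -> greedy_output H s m.+1 out.

(* State after t iterations of randomized greedy local search, when the
   candidate drawn in iteration j (counted from 0) is [cand j]. *)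
Fixpoint rgls_state {R : realType} {n : nat} (H : config n -> R)
    (s0 : config n) (cand : nat -> config n) (t : nat) : config n :=
  if t is t'.+1 then
    let s := rgls_state H s0 cand t' in
    if H s < H (cand t') then cand t' else s
  else s0.

Section probability.
Context {R : realType} {d : measure_display} {T : measurableType d}.
Variable P : probability T R.

Definition mutually_independent {I : finType} (X : I -> {RV P >-> R}) : Prop :=
  forall (J : {set I}) (B : I -> set R),
    (forall i, measurable (B i)) ->
    P (\bigcap_(i in [set` J]) X i @^-1` B i) =
    (\prod_(i in J) P (X i @^-1` B i))%E.

Definition iid_std_normal {I : finType} (X : I -> {RV P >-> R}) : Prop :=
  mutually_independent X /\
  forall i (B : set R), measurable B ->
    distribution P (X i) B = normal_prob 0 1 B.

(* The sigma-algebra generated by the noise W and the candidates drawn before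
   iteration t. *)
Definition history {I : finType} {n : nat} (W : I -> {RV P >-> R})
    (cand : nat -> T -> config n) (t : nat) : set (set T) :=
  <<s [set A | (exists (i : I) (B : set R),
                  measurable B /\ A = W i @^-1` B) \/
               (exists (j : nat) (s : config n),
                  (j < t)%N /\ A = [set w | cand j w = s]) ] >>.

(* [cand t w] is the candidate drawn in iteration t < M, for the (random)
   objective [H w]: conditionally on the noise and on all previous draws, it is
   uniform on the neighborhood of the current state. *)
Definition uniform_draws {I : finType} {n : nat} (W : I -> {RV P >-> R})
    (H : T -> config n -> R) (s0 : config n) (M : nat)
    (cand : nat -> T -> config n) : Prop :=
  forall t, (t < M)%N ->
    (forall s, measurable [set w | cand t w = s]) /\
    forall (A : set T) (s s' : config n),
      history W cand t A -> s' \in neighborhood s ->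
      let A_s := A `&` [set w | rgls_state (H w) s0 (cand^~ w) t = s] in
      P (A_s `&` [set w | cand t w = s']) =
      ((#|neighborhood s|%:R^-1)%:E * P A_s)%E.

End probability.

(* Main.v *)
Require Import Defs.
From HB Require Import structures.
From mathcomp Require Import all_boot all_order all_algebra.
From mathcomp Require Import all_classical all_reals all_analysis.
From mathcomp Require Import measurable_realfun ring lra zify.
Set Implicit Arguments.
Unset Strict Implicit.
Unset Printing Implicit Defensive.
Import Order.TTheory GRing.Theory Num.Theory.
Import numFieldNormedType.Exports.
Local Open Scope classical_set_scope.
Local Open Scope ring_scope.

(** Restricted to states [s] whose nonzero entries agree with [theta], with
    [m = norm0 s >= 2], moving to a neighbour [s'] changes the objective by a
    signal term, a penalty term and a Gaussian [<s'^r - s^r, W>] of variance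
    [O(m^(r-1))].  A Chernoff bound with exponent [m log n] and the union bound
    weighted by [sum_s n^(-2 norm0 s) = (1 + 2 / n^2)^n = O(1)] show that, up to
    probability [O(n^-3)], all these Gaussians are smaller than
    [c sqrt(log n) m^(r-1)] simultaneously.  As both [gamma] and
    [lambda / k^(r/2) - gamma] exceed [c sqrt(log n)], the strictly improving
    moves are then exactly the additions of a correct coordinate: greedy search
    needs [k - 2] of them.  For the randomized search, each missing coordinate
    is drawn with probability [1 / (2 n)] per iteration independently of the
    past, hence survives [M >= 6 n log n] iterations with probability at most
    [n^-3]. *)

(** * Integration against the image of a weighted measure *)

Section weighted_measure.
Context {R : realType} {d d' : measure_display}.
Context {T : measurableType d} {X : measurableType d'}.
Context (nu : {measure set T -> \bar R}) (mu : {measure set X -> \bar R}).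
Context (phi : T -> X) (g : T -> R) (c : R).
Hypotheses (mphi : measurable_fun setT phi) (mg : measurable_fun setT g).
Hypothesis g0 : forall x, 0 <= g x.
Hypothesis gE : forall B, measurable B ->
  (\int[nu]_(x in phi @^-1` B) (g x)%:E = c%:E * mu B)%E.

Import HBNNSimple.

(** Expanding [f] over its finitely many values leaves [gE] on each level set of [f]. *)
Let integral_weighted_nnsfun (f : {nnsfun X >-> R}) :
  (\int[nu]_x (f (phi x) * g x)%:E = c%:E * \int[mu]_x (f x)%:E)%E.
Proof.
pose h y (x : T) : \bar R := (\1_(f @^-1` [set y]) (phi x) * g x)%:E.
have mpre y : measurable (phi @^-1` (f @^-1` [set y])).
  by rewrite -[X in measurable X]setTI; exact: mphi.
have mh y : measurable_fun setT (h y).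
  apply/measurable_EFinP/measurable_funM => //.
  exact: (measurableT_comp (measurable_indic _)).
have h0 y x : (0 <= y%:E * h y x)%E.
  by rewrite /h EFinM muleA; apply: mule_ge0; [exact: nnfun_muleindic_ge0|rewrite lee_fin].
transitivity (\int[nu]_x (\sum_(y \in range f) (y%:E * h y x)))%E.
  apply: eq_integral => x _; rewrite fimfunE EFinM -fsumEFin//.
  rewrite ge0_mule_fsuml; last by move=> y; exact: nnfun_muleindic_ge0.
  by apply: eq_fsbigr => y _; rewrite /h !EFinM muleA.
rewrite ge0_integral_fsum//; last by move=> y; exact: measurable_funeM.
rewrite integralT_nnsfun sintegralE ge0_mule_fsumr; last first.
  by move=> y; exact: nnsfun_mulemu_ge0.
apply: eq_fsbigr => y; rewrite inE => -[x _ fxy].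
have y0 : 0 <= y by rewrite -fxy.
rewrite ge0_integralZl//; last first.
  by move=> z _; rewrite lee_fin mulr_ge0// indicE ler0n.
rewrite muleCA -gE//; congr (_ * _)%E.
rewrite [RHS]integral_mkcond; apply: eq_integral => z _.
rewrite /h indicE patchE /=.
rewrite [z \in _](_ : _ = (phi z \in f @^-1` [set y])); last first.
  by apply/idP/idP; rewrite !inE.
by case: ifP => _; rewrite ?mul1r ?mul0r.
Qed.

(** Monotone convergence along simple approximations of [f]. The lemma serves twice: with [phi] the
    identity it introduces the normal density, and with [phi] one of the Gaussians it integrates
    that variable out. *)
Lemma integral_weighted (f : X -> R) : measurable_fun setT f ->
  (forall x, 0 <= f x) ->
  (\int[nu]_x (f (phi x) * g x)%:E = c%:E * \int[mu]_x (f x)%:E)%E.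
Proof.
move=> mf f0.
have mfE : measurable_fun setT (EFin \o f) by apply/measurable_EFinP.
pose h := nnsfun_approx measurableT mfE.
have hf x : EFin \o h^~ x @ \oo --> (f x)%:E.
  by apply: cvg_nnsfun_approx => // y _; rewrite lee_fin.
have hnd x : {homo (h^~ x) : a b / (a <= b)%N >-> a <= b}.
  by move=> a b ab; exact/lefP/nd_nnsfun_approx.
transitivity (limn (fun n => \int[nu]_x (h n (phi x) * g x)%:E))%E.
  rewrite -monotone_convergence//.
  - apply: eq_integral => x _; apply/esym/cvg_lim => //.
    rewrite (_ : (fun n => _) = fun n => ((h n (phi x))%:E * (g x)%:E)%E)//.
    by rewrite EFinM; apply: cvgeZr => //; exact: hf.
  - move=> n; apply/measurable_EFinP/measurable_funM => //.
    exact: measurableT_comp.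
  - by move=> n x _; rewrite lee_fin mulr_ge0.
  - by move=> x _ a b ab; rewrite lee_fin ler_wpM2r// hnd.
under eq_fun do rewrite integral_weighted_nnsfun.
apply/cvg_lim => //; apply: cvgeZl => //.
have -> : (\int[mu]_x (f x)%:E = \int[mu]_x limn (fun n => (h n x)%:E))%E.
  by apply: eq_integral => x _; apply/esym/cvg_lim => //; exact: hf.
apply: cvg_monotone_convergence => //.
- by move=> n; apply/measurable_EFinP.
- by move=> n x _; rewrite lee_fin.
- by move=> x _ a b ab; rewrite lee_fin hnd.
Qed.

End weighted_measure.

(** * Exponential moments and tails of linear forms in i.i.d. Gaussians *)

Lemma measurable_weighted_sum {R : realType} {d : measure_display}
    {T : measurableType d} {I : Type} (c : I -> R) (X : I -> T -> R) (s : seq I) :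
    (forall i, measurable_fun setT (X i)) ->
  measurable_fun setT (fun w => \sum_(i <- s) c i * X i w).
Proof. by move=> mX; apply: measurable_sum => i; exact: measurable_funM. Qed.

Section gaussian_sums.
Context {R : realType}.

Lemma integral_normal_prob_expR (t : R) :
  (\int[normal_prob 0 1]_x (expR (t * x))%:E = (expR (t ^+ 2 / 2))%:E)%E.
Proof.
have mexp : measurable_fun setT (fun x : R => expR (t * x)).
  by apply: measurableT_comp => //; exact: mulrl_measurable.
rewrite -[LHS]mul1e -(@integral_weighted _ _ _ _ _ lebesgue_measure
    (normal_prob 0 1) idfun (normal_pdf 0 1) 1) //=; last 4 first.
- exact: measurable_id.
- exact: measurable_normal_pdf.
- by move=> x; exact: normal_pdf_ge0.
- by move=> B mB; rewrite mul1e.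
(* completing the square: the mean moves to t *)
rewrite (_ : (fun x => _) = fun x =>
    (expR (t ^+ 2 / 2))%:E * (normal_pdf t 1 x)%:E)%E; last first.
  apply/funext => x; rewrite -EFinM; congr EFin.
  rewrite !normal_pdfE// mulrCA [RHS]mulrCA; congr (_ * _).
  by rewrite /normal_fun -!expRD; congr expR; field.
rewrite ge0_integralZl//; last 2 first.
- by apply/measurable_EFinP; exact: measurable_normal_pdf.
- by move=> x _; rewrite lee_fin normal_pdf_ge0.
by rewrite integral_normal_pdf mule1.
Qed.

Context {d : measure_display} {T : measurableType d} (P : probability T R).
Context {I : finType} (X : I -> {RV P >-> R}).
Hypothesis iidX : iid_std_normal X.

Let cylinder (J : {set I}) (B : I -> set R) : set T :=
  \bigcap_(i in [set` J]) X i @^-1` B i.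

Let measurable_cylinder J B : (forall i, measurable (B i)) ->
  measurable (cylinder J B).
Proof.
move=> mB; apply: fin_bigcap_measurable; first exact: finite_finset.
by move=> i _; rewrite -[X in measurable X]setTI; exact: measurable_funP.
Qed.

(* The events on the remaining variables make the induction on [s] go through:
   the integral over [X a @^-1` B] is, as a function of [B], a multiple of the
   law of [X a]. *)
Let integral_expR_sum_cylinder (c : I -> R) (s : seq I) :
  uniq s -> forall (J : {set I}) (B : I -> set R), (forall i, measurable (B i)) ->
  {in s, forall i, i \notin J} ->
  (\int[P]_(w in cylinder J B) (expR (\sum_(i <- s) c i * X i w))%:E
   = (expR (\sum_(i <- s) c i ^+ 2 / 2))%:E * P (cylinder J B))%E.
Proof.
have [indX distX] := iidX.
elim: s => [_ J B mB _|a s IH /= /andP[as' us] J B mB sJ].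
  under eq_integral do rewrite big_nil expR0.
  by rewrite big_nil expR0 mul1e integral_cst ?mul1e//; exact: measurable_cylinder.
have aJ : a \notin J by apply: sJ; rewrite mem_head.
set D := cylinder J B.
have mD : measurable D by exact: measurable_cylinder.
have PD : P D \is a fin_num by exact: fin_num_measure.
(* The part of the integrand that does not involve [X a]; it is the weight in
   [integral_weighted]. *)
pose g w := expR (\sum_(i <- s) c i * X i w) * \1_D w.
have mg : measurable_fun setT g.
  apply: measurable_funM => //.
  by apply: measurableT_comp => //; exact: measurable_weighted_sum.
have g0 w : 0 <= g w by rewrite mulr_ge0// expR_ge0.
have gE B0 : measurable B0 -> (\int[P]_(w in X a @^-1` B0) (g w)%:E =
    (expR (\sum_(i <- s) c i ^+ 2 / 2) * fine (P D))%:E * normal_prob 0 1 B0)%E.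
  (* Adding the constraint [B0] at index [a] yields a cylinder again, so the induction hypothesis
     applies, and independence then splits off the law of [X a]. *)
  move=> mB0; pose B1 i := if i == a then B0 else B i.
  have mB1 i : measurable (B1 i) by rewrite /B1; case: ifP.
  have DE : cylinder (a |: J) B1 = X a @^-1` B0 `&` D.
    apply/seteqP; split => [w Hw|w [Ha Hw] i /=].
      split; first by have := Hw a; rewrite /B1 eqxx /= setU11; exact.
      move=> i /= iJ; have := Hw i; rewrite /B1 /= setU1r//.
      by case: eqP => [ia|_]; [rewrite ia (negPf aJ) in iJ|exact].
    rewrite !inE /B1; case: eqP => [-> _|_ /= iJ]; first exact: Ha.
    exact: Hw.
  transitivity (\int[P]_(w in cylinder (a |: J) B1)
      (expR (\sum_(i <- s) c i * X i w))%:E)%E.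
    rewrite DE integral_mkcondr; apply: eq_integral => w _.
    by rewrite patchE /g indicE; case: ifP; rewrite ?mulr1 ?mulr0.
  rewrite (IH us)//; last first.
    move=> i is'; rewrite !inE negb_or sJ ?inE ?is' ?orbT// andbT.
    by apply: contraNneq as' => <-.
  rewrite EFinM -muleA; congr (_ * _)%E.
  rewrite [LHS](indX (a |: J) B1 mB1) (big_setU1 _ aJ)/= {1}/B1 eqxx.
  rewrite fineK// [P D](indX J B mB) muleC; congr (_ * _)%E.
    apply: eq_bigr => i iJ; rewrite /B1; case: eqP => // ia.
    by rewrite ia (negPf aJ) in iJ.
  exact: distX.
transitivity (\int[P]_w (expR (c a * X a w) * g w)%:E)%E.
  rewrite integral_mkcond; apply: eq_integral => w _.
  rewrite patchE /g indicE big_cons expRD mulrA.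
  by case: ifP; rewrite ?mulr1 ?mulr0.
have mXa : measurable_fun setT (X a) by exact: measurable_funP.
have mexp : measurable_fun setT (fun x : R => expR (c a * x)).
  by apply: measurableT_comp => //; exact: mulrl_measurable.
rewrite (@integral_weighted _ _ _ _ _ P (normal_prob 0 1) (X a) g _
  mXa mg g0 gE _ mexp)//.
rewrite integral_normal_prob_expR -EFinM big_cons expRD.
by rewrite -[in RHS](fineK PD) -EFinM; congr EFin; ring.
Qed.

Lemma integral_expR_gaussian_sum (c : I -> R) :
  (\int[P]_w (expR (\sum_i c i * X i w))%:E
   = (expR (\sum_i c i ^+ 2 / 2))%:E)%E.
Proof.
have uI : uniq (index_enum I) := index_enum_uniq I.
have mT i : measurable ((fun _ : I => [set: R]) i) by exact: measurableT.
have := integral_expR_sum_cylinder c uI mT (J := finset.set0).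
rewrite (_ : cylinder _ _ = setT); last first.
  by apply/seteqP; split => // w _ i.
by rewrite probability_setT mule1; apply => i _; rewrite inE.
Qed.

(** Chernoff's bound: the indicator of the event is at most the exponential of [t] times the sum
    minus [x]. Since [t] may have either sign, both tails are covered. *)
Lemma gaussian_sum_tail (c : I -> R) (t x : R) :
  (P [set w | (x <= t * \sum_i c i * X i w)%R]
   <= (expR (t ^+ 2 * (\sum_i c i ^+ 2) / 2 - x))%:E)%E.
Proof.
set A := [set w | _].
have mS : measurable_fun setT (fun w => \sum_i (t * c i) * X i w).
  exact: measurable_weighted_sum.
have SE w : t * \sum_i c i * X i w = \sum_i (t * c i) * X i w.
  by rewrite mulr_sumr; apply: eq_bigr => i _; rewrite mulrA.
have mA : measurable A.
  rewrite /A; under eq_set do rewrite SE.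
  by rewrite -[X in measurable X]setTI; exact: measurable_fun_le.
have mE : measurable_fun setT
    (fun w => (expR (\sum_i (t * c i) * X i w))%:E).
  by apply/measurable_EFinP/measurableT_comp.
have -> : (P A = \int[P]_w (\1_A w)%:E)%E by rewrite integral_indic// setIT.
apply: (@le_trans _ _ (\int[P]_w ((expR (- x))%:E *
    (expR (\sum_i (t * c i) * X i w))%:E))%E).
  apply: ge0_le_integral => //.
  - by apply/measurable_EFinP; exact: measurable_indic.
  - exact: measurable_funeM.
  - move=> w _; rewrite -EFinM lee_fin indicE -expRD.
    have [|_] := boolP (w \in A); last exact: expR_ge0.
    rewrite inE /A /= SE => Aw; rewrite -[leLHS]expR0 ler_expR; lra.
rewrite ge0_integralZl//.
rewrite integral_expR_gaussian_sum -EFinM lee_fin -expRD ler_expR addrC.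
rewrite lerD2r mulr_sumr mulr_suml ler_sum// => i _.
by rewrite exprMn.
Qed.

End gaussian_sums.

(** * Configurations, their neighbours and their overlap with [theta] *)

Section configurations.
Context {n : nat}.
Implicit Types (s theta : config n) (i : 'I_n) (v : spin).

(** A coordinatewise form of the equality of [dot (vec s) (vec theta)] and [norm0 s]; see
    [dot_agrees] and [dot_norm0_agrees]. *)
Definition agrees s theta : bool :=
  [forall i, (ssval (s i) != 0) ==> (s i == theta i)].

Definition set_spin s i v : config n :=
  [ffun j => if j == i then v else s j].

Lemma agreesP s theta :
  reflect (forall i, ssval (s i) != 0 -> s i = theta i) (agrees s theta).
Proof.
apply: (iffP forallP) => [H i si|H i]; last by apply/implyP => /H ->.
by apply/eqP; have /implyP := H i; apply.
Qed.

Lemma spin_cases v : [\/ ssval v = -1, ssval v = 0 | ssval v = 1].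
Proof.
have := ssvalP v; rewrite !inE => /or3P[] /eqP vE.
- by constructor 1.
- by constructor 2.
- by constructor 3.
Qed.

Lemma neighborhoodP s s' :
  reflect (exists i v, v != s i /\ s' = set_spin s i v)
          (s' \in neighborhood s).
Proof.
rewrite inE; apply: (iffP cards1P) => [[i Ei]|[i [v [vs ->]]]].
  have nE j : (s j != s' j) = (j == i).
    by rewrite -(finset.in_set1 j i) -Ei inE.
  exists i, (s' i); split; first by rewrite eq_sym nE.
  apply/ffunP => j; rewrite ffunE; have [->//|ji] := eqVneq j i.
  by apply/esym/eqP; rewrite -[_ == _]negbK nE.
exists i; apply/setP => j; rewrite !inE ffunE.
by have [->|ji] := eqVneq j i; [rewrite eq_sym vs|rewrite eqxx].
Qed.

Lemma norm0_sum s : norm0 s = (\sum_i (ssval (s i) != 0))%N.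
Proof.
rewrite /norm0 -sum1_card big_mkcond; apply: eq_bigr => i _.
by rewrite inE; case: (_ != 0).
Qed.

(** The additive form avoids truncated subtraction, both for [lia] and when cast to [R]. *)
Lemma norm0_set_spin s i v :
  (norm0 (set_spin s i v) + (ssval (s i) != 0) =
   norm0 s + (ssval v != 0))%N.
Proof.
rewrite !norm0_sum (bigD1 i)//= [in RHS](bigD1 i)//= ffunE eqxx.
have -> : (\sum_(j < n | j != i) (ssval (set_spin s i v j) != 0) =
    \sum_(j < n | j != i) (ssval (s j) != 0))%N.
  by apply: eq_bigr => j /negPf ji; rewrite ffunE ji.
by rewrite addnAC [RHS]addnAC [X in (X + _)%N = _]addnC.
Qed.

Lemma norm0_neighbor s s' : s' \in neighborhood s -> (norm0 s' <= (norm0 s).+1)%N.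
Proof.
move=> /neighborhoodP[i [v [_ ->]]]; have := norm0_set_spin s i v; lia.
Qed.

Lemma agrees_refl s : agrees s s. Proof. exact/agreesP. Qed.

Lemma agrees_norm0 s theta : agrees s theta -> (norm0 s <= norm0 theta)%N.
Proof.
move=> /agreesP H; rewrite !norm0_sum; apply: leq_sum => i _.
by case: eqP => //= /eqP /[dup] si /H <-; rewrite si.
Qed.

Lemma agrees_neq_ex s theta : agrees s theta -> s != theta ->
  exists2 i, ssval (s i) = 0 & ssval (theta i) != 0.
Proof.
move=> /agreesP H; apply: contra_neqP => Hn; apply/ffunP => i.
have [si|/H//] := eqVneq (ssval (s i)) 0.
have [ti|ti] := eqVneq (ssval (theta i)) 0; last by case: Hn; exists i.
by apply/val_inj; rewrite /= si ti.
Qed.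

Lemma agrees_set_spin s theta i : agrees s theta ->
  agrees (set_spin s i (theta i)) theta.
Proof.
move=> /agreesP H; apply/agreesP => j; rewrite ffunE.
by have [->|_] := eqVneq j i; [|exact: H].
Qed.

(** Neighbours correspond bijectively to a site together with one of the two spins that differ from
    the current one. *)
Lemma neighborhood_card s : #|neighborhood s| = (2 * n)%N.
Proof.
have cs : #|spin| = 3%N by rewrite card_seq_sub.
pose A := [set p : 'I_n * spin | p.2 != s p.1]%SET.
have -> : neighborhood s = [set set_spin s p.1 p.2 | p in A]%SET.
  apply/setP => s'; apply/neighborhoodP/imsetP.
    by move=> [i [v [vi ->]]]; exists (i, v); rewrite // inE.
  by move=> [[i v]]; rewrite inE /= => vi ->; exists i, v.
rewrite card_in_imset; last first.
  move=> [i v] [j u]; rewrite !inE /= => vi uj /ffunP E.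
  have := E i; have := E j; rewrite !ffunE !eqxx.
  have [-> -> //|ji Eu _] := eqVneq j i.
  by rewrite Eu eqxx in uj.
rewrite -sum1_card (eq_bigl (fun p => true && (p.2 != s p.1))); last first.
  by move=> p; rewrite inE.
rewrite -(pair_big_dep predT (fun i v => v != s i) (fun _ _ => 1%N))/=.
under eq_bigr => i _.
  rewrite sum1_card (cardC1 (s i)) cs; over.
by rewrite sum_nat_const card_ord mulnC.
Qed.

Context {R : realType}.

Lemma vec_mul s theta i :
  vec s i * vec theta i = (ssval (s i) * ssval (theta i))%:~R :> R.
Proof. by rewrite /vec intrM. Qed.

Lemma dot_agrees s theta : agrees s theta ->
  dot (vec s) (vec theta) = (norm0 s)%:R :> R.
Proof.
move=> /agreesP H; rewrite norm0_sum natr_sum; apply: eq_bigr => i _.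
rewrite vec_mul; have [->|si] := eqVneq (ssval (s i)) 0; first by rewrite mul0r.
by rewrite -H//=; case: (spin_cases (s i)) si => ->.
Qed.

(** Each coordinate contributes at most the indicator that [s i] is nonzero, so equality of the sums
    forces equality term by term. *)
Lemma dot_norm0_agrees s theta :
  dot (vec s) (vec theta) = (norm0 s)%:R :> R -> agrees s theta.
Proof.
move=> E; apply/agreesP => i si; apply/val_inj => /=.
have le j : vec s j * vec theta j <= (ssval (s j) != 0)%:R :> R.
  rewrite vec_mul; case: (spin_cases (s j)) => ->;
    case: (spin_cases (theta j)) => -> //=; rewrite ?mulr0 ?mul0r //; lra.
have /eqP : \sum_j ((ssval (s j) != 0)%:R - vec s j * vec theta j) = 0 :> R.
  by rewrite sumrB -natr_sum -norm0_sum -E subrr.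
rewrite psumr_eq0 => [|j _]; last by rewrite subr_ge0.
move=> /allP/(_ i (mem_index_enum _)) /=; rewrite vec_mul si.
case: (spin_cases (s i)) si => -> //= _; case: (spin_cases (theta i)) => -> //=;
  rewrite ?mulr0 ?subr_eq0 => /eqP H; exfalso; move: H; lra.
Qed.

Lemma dot_set_spin s i v (u : 'I_n -> R) :
  dot (vec (set_spin s i v)) u =
  dot (vec s) u + ((ssval v)%:~R - (ssval (s i))%:~R) * u i.
Proof.
rewrite /dot (bigD1 i)//= [in RHS](bigD1 i)//= /vec ffunE eqxx.
rewrite (eq_bigr (fun j => vec s j * u j)) /vec; last first.
  by move=> j /negPf ji; rewrite ffunE ji.
ring.
Qed.

(* In the last two cases the neighbour is not a step towards [theta]; the
   overlap with [theta] is then at most [norm0 s], and drops if the norm does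
   not grow. *)
Lemma neighbor_cases s s' theta : agrees s theta -> (2 <= norm0 s)%N ->
  s' \in neighborhood s ->
  [\/ agrees s' theta /\ norm0 s' = (norm0 s).+1,
      exists2 y, [/\ norm0 s' = (norm0 s).+1, ~~ agrees s' theta &
                     (y <= norm0 s)%N] &
                 dot (vec s') (vec theta) = y%:R :> R |
      exists2 y, [/\ (norm0 s' <= norm0 s)%N, (y <= norm0 s')%N &
                     (y < norm0 s)%N] &
                 dot (vec s') (vec theta) = y%:R :> R].
Proof.
move=> sth m2 /neighborhoodP[i [v [vi ->]]].
have := norm0_set_spin s i v; set x := norm0 (set_spin s i v).
set m := norm0 s in m2 * => xE.
rewrite dot_set_spin dot_agrees// -/m /vec.
have vsi : ssval v != ssval (s i) by apply: contraNneq vi => /val_inj ->.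
have Ag : ~~ agrees (set_spin s i v) theta \/ agrees (set_spin s i v) theta.
  by case: agrees; [right|left].
have Nag : agrees (set_spin s i v) theta -> ssval v != 0 -> v = theta i.
  by move=> /agreesP /(_ i); rewrite ffunE eqxx.
have m1 : (m - 1)%:R = m%:R - 1 :> R by rewrite natrB //; lia.
have m3 : (m - 2)%:R = m%:R - 2 :> R by rewrite natrB.
(* Filling an empty site raises the norm by one; the overlap changes by the product of [v] and
   [theta i], which is positive only for the correct spin. *)
have [si|si] := eqVneq (ssval (s i)) 0.
  have v0 : ssval v != 0 by move: vsi; rewrite si.
  have xm : x = m.+1 by move: xE; rewrite si v0 eqxx /=; lia.
  case: Ag => Ag; last by constructor 1.
  have vt : ssval v != ssval (theta i).
    apply: contraNneq Ag => /val_inj ->; exact: agrees_set_spin.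
  constructor 2; rewrite si subr0.
  case: (spin_cases (theta i)) vt => -> vt.
  - exists (m - 1)%N; first by split => //; lia.
    by rewrite m1; case: (spin_cases v) vt v0 => -> // _ _; ring.
  - by exists m; [split|rewrite mulr0 addr0].
  - exists (m - 1)%N; first by split => //; lia.
    by rewrite m1; case: (spin_cases v) vt v0 => -> // _ _; ring.
(* Here the site already carries the correct spin: erasing it loses one unit of overlap, flipping it
   loses two. *)
have tE := agreesP _ _ sth i si.
constructor 3; rewrite -tE.
have [v0|v0] := eqVneq (ssval v) 0.
  have xm : x = (m - 1)%N by move: xE; rewrite si v0 eqxx /=; lia.
  exists (m - 1)%N; first by rewrite xm; split; lia.
  by rewrite m1 v0; case: (spin_cases (s i)) si => -> // _; ring.
have xm : x = m by move: xE; rewrite si v0 /=; lia.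
exists (m - 2)%N; first by rewrite xm; split; lia.
rewrite m3; case: (spin_cases (s i)) si vsi => -> // _;
  case: (spin_cases v) v0 => -> // _ _; ring.
Qed.

End configurations.

(** * Greedy search on an objective with the climbing property *)

Section local_search.
Context {R : realType} {n : nat}.
Implicit Types (s theta : config n) (H : config n -> R).

(* The strict improvements are exactly the additions of a correct coordinate,
   so the greedy trajectory stays below [theta] whatever the tie-breaking. *)
Definition climbing H theta : Prop :=
  forall s s', agrees s theta -> (2 <= norm0 s)%N -> s' \in neighborhood s ->
  (H s < H s') = agrees s' theta && (norm0 s < norm0 s')%N.

Lemma agrees_add_spin s theta i : agrees s theta ->
    ssval (s i) = 0 -> ssval (theta i) != 0 ->
  let s' := set_spin s i (theta i) in
  [/\ s' \in neighborhood s, agrees s' theta & norm0 s' = (norm0 s).+1].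
Proof.
move=> sth si ti s'; split.
- apply/neighborhoodP; exists i, (theta i); split => //.
  by apply: contraNneq ti => ->; rewrite si.
- exact: agrees_set_spin.
- by have := norm0_set_spin s i (theta i); rewrite si eqxx ti addn0 addn1.
Qed.

Lemma agrees_norm0_eq s theta : agrees s theta -> norm0 s = norm0 theta ->
  s = theta.
Proof.
move=> sth E; apply/eqP; apply: contraT => /(agrees_neq_ex sth)[i si ti].
have [_ /agrees_norm0 + N] := agrees_add_spin sth si ti.
by rewrite N E ltnn.
Qed.

Lemma is_argmax_ex H s s' : s' \in neighborhood s -> exists loc, is_argmax H s loc.
Proof.
move=> Ns'; case: (arg_maxP H Ns') => loc Nloc Hloc.
by exists loc; split.
Qed.

Lemma norm0_gt0_neighbor s : (0 < norm0 s)%N -> exists s', s' \in neighborhood s.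
Proof.
move=> s0; apply/set0Pn; rewrite -card_gt0 neighborhood_card.
rewrite muln_gt0 /=; apply: leq_trans s0 _.
by rewrite -[leqRHS]card_ord max_card.
Qed.

(** Each improving step adds exactly one correct coordinate, so the norm counts the steps.
    Uniqueness is an induction on the run, hence independent of tie-breaking; existence is an
    induction on the number of missing coordinates. *)
Lemma greedy_climbing H theta s m out : climbing H theta ->
    agrees s theta -> (2 <= norm0 s)%N ->
  greedy_output H s m out <-> m = (norm0 theta - norm0 s)%N /\ out = theta.
Proof.
move=> clH sth s2; split.
  move=> G; elim: G sth s2 => {s m out} [s loc [Nloc Mloc] stop|].
    move=> sth s2; suff -> : s = theta by rewrite subnn.
    apply/eqP; apply: contraT => /(agrees_neq_ex sth)[i si ti].
    have [Ns' ag nE] := agrees_add_spin sth si ti.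
    have : H s < H (set_spin s i (theta i)) by rewrite clH// ag nE ltnS leqnn.
    by move=> /lt_le_trans/(_ (Mloc _ Ns')); rewrite (negPf stop).
  move=> s loc m out [Nloc _] up _ IH sth s2.
  move: up; rewrite clH// => /andP[locth locn].
  have locE : norm0 loc = (norm0 s).+1.
    by apply/eqP; rewrite eqn_leq locn norm0_neighbor.
  have [||-> ->] := IH => //; first by rewrite locE; lia.
  by split=> //; have := agrees_norm0 locth; rewrite locE; lia.
move=> [-> ->]; move E : (norm0 theta - norm0 s)%N => k.
elim: k s sth s2 E => [|k IH] s sth s2 E.
  have -> : s = theta.
    apply: agrees_norm0_eq => //; have := agrees_norm0 sth; lia.
  (* Even stopping requires a maximizer, so [theta] must be shown to have a neighbour. *)
  have t2 : (2 <= norm0 theta)%N by apply: leq_trans s2 (agrees_norm0 sth).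
  have [s' /(is_argmax_ex H)[loc Mloc]] := norm0_gt0_neighbor (ltnW t2).
  have [Nloc _] := Mloc; apply: greedy_stop Mloc _.
  rewrite clH ?agrees_refl//; apply/negP => /andP[/agrees_norm0].
  by rewrite leqNgt => /negP.
have st : s != theta.
  by apply/eqP => sE; move: E; rewrite sE subnn.
have [i si ti] := agrees_neq_ex sth st.
have [Ns' ag nE] := agrees_add_spin sth si ti.
have [loc Mloc] := is_argmax_ex H Ns'; have [Nloc lemax] := Mloc.
have up : H s < H loc.
  by apply: lt_le_trans (lemax _ Ns'); rewrite clH// ag nE ltnS leqnn.
have := up; rewrite clH// => /andP[locth locn].
apply: greedy_step Mloc up _.
have locE : norm0 loc = (norm0 s).+1.
  by apply/eqP; rewrite eqn_leq locn norm0_neighbor.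
apply: IH => //; first by lia.
by rewrite locE; lia.
Qed.

(** Runs see the objective only through strict comparisons; this later makes the greedy event
    measurable. *)
Lemma greedy_output_ext (H1 H2 : config n -> R) s m out :
    (forall s s', (H1 s < H1 s') = (H2 s < H2 s')) ->
  greedy_output H1 s m out -> greedy_output H2 s m out.
Proof.
move=> E; have argE s0 loc : is_argmax H1 s0 loc -> is_argmax H2 s0 loc.
  move=> [Nloc M]; split=> // s' Ns'.
  by rewrite leNgt -E -leNgt M.
elim=> {s m out} [s loc /argE Mloc stop|s loc m out /argE Mloc up _ IH].
  by apply: greedy_stop Mloc _; rewrite -E.
by apply: greedy_step Mloc _ IH; rewrite -E.
Qed.

End local_search.

(** * Signal and penalty against the noise *)

Section signal_plus_noise.
Context {R : realType}.

(** Distributing a product of [r] equal sums gives one sum over all multi-indices. *)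
Lemma dot_tpow {r n : nat} (u v : 'I_n -> R) :
  dot (tpow r u) (tpow r v) = dot u v ^+ r.
Proof.
rewrite /dot /tpow -[in RHS](card_ord r) -prodr_const.
rewrite (bigA_distr_bigA (fun (_ : 'I_r) i => u i * v i)).
by apply: eq_bigr => a _; rewrite big_split.
Qed.

(** Replacing [y ^+ r.-1] by the larger [x ^+ r.-1] leaves [(x - y) * x ^+ r.-1]. Thus a unit change
    of norm or overlap is worth at least the noise scale. *)
Lemma exprB_ge (x y : R) (r : nat) : (0 < r)%N -> 0 <= y -> y + 1 <= x ->
  x ^+ r.-1 <= x ^+ r - y ^+ r.
Proof.
case: r => // r _ y0 yx /=.
have x0 : 0 <= x by lra.
have H : y ^+ r <= x ^+ r by apply: lerXn2r; rewrite ?nnegrE//; lra.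
have X0 : 0 <= x ^+ r by rewrite exprn_ge0.
rewrite !exprS; have := ler_wpM2l y0 H; nra.
Qed.

Context {r n : nat}.
Implicit Types (s theta : config n) (W : midx r n -> R).

Lemma objective_observation gamma lambda k theta W s :
  objective gamma (observation lambda k theta W) s =
  lambda / k%:R `^ (r%:R / 2) * dot (vec s) (vec theta) ^+ r
  - gamma * (norm0 s)%:R ^+ r + dot (tpow r (vec s)) W.
Proof.
rewrite /objective /observation addrAC; congr (_ - _).
rewrite -dot_tpow /dot mulr_sumr -big_split; apply: eq_bigr => a _ /=.
by rewrite mulrDr mulrCA.
Qed.

(** With [l] the signal strength and [m] the norm, the noise moves by less than [b * m ^+ r.-1]. A
    correct addition gains at least [l - gamma] times this power of [m]; a wrong addition pays at
    least [gamma] times it, with no gain in signal. *)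
Lemma climbing_objective gamma lambda k theta W (b : R) : (0 < r)%N ->
    0 <= b -> b <= gamma -> b + gamma <= lambda / k%:R `^ (r%:R / 2) ->
    (forall s s', (2 <= norm0 s)%N -> s' \in neighborhood s ->
       `|dot (tpow r (vec s')) W - dot (tpow r (vec s)) W|
       < b * (norm0 s)%:R ^+ r.-1) ->
  climbing (objective gamma (observation lambda k theta W)) theta.
Proof.
move=> r0 b0 bg bgl noise s s' sth s2 Ns'.
have := noise _ _ s2 Ns'; rewrite ltr_norml => /andP[lo up].
rewrite !objective_observation (dot_agrees sth).
move: lo up bgl; set N' := dot (tpow r (vec s')) W.
set N := dot (tpow r (vec s)) W; set l := lambda / _.
set m := norm0 s in s2 *; set p := m%:R ^+ r.-1 => lo up bgl.
have m0 : 0 <= m%:R :> R by [].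
have p0 : 0 <= p by rewrite exprn_ge0.
have mS : m.+1%:R = m%:R + 1 :> R by rewrite -natr1.
have grow : p <= (m.+1)%:R ^+ r - m%:R ^+ r.
  apply: (@le_trans _ _ (m.+1%:R ^+ r.-1)).
    by apply: lerXn2r; rewrite ?nnegrE ?ler_nat.
  by apply: exprB_ge => //; rewrite mS.
case: (neighbor_cases (R := R) sth s2 Ns') => [[ag nE]|[y [nE Nag ym] yE]|[y [nm yn ym] yE]].
- rewrite ag nE ltnS leqnn (dot_agrees ag) nE -/m.
  have H : b * p <= (l - gamma) * (m.+1%:R ^+ r - m%:R ^+ r).
    by apply: ler_pM => //; lra.
  by lra.
- rewrite (negPf Nag) nE yE /=; apply/negbTE; rewrite -leNgt.
  have H : b * p <= gamma * (m.+1%:R ^+ r - m%:R ^+ r) by apply: ler_pM => //; lra.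
  have Y : y%:R ^+ r <= m%:R ^+ r :> R by apply: lerXn2r; rewrite ?nnegrE ?ler_nat.
  have l0 : 0 <= l by lra.
  have := ler_wpM2l l0 Y; lra.
(* As the overlap [y] is at most the new norm, the penalty refund is at most [gamma] times the drop
   from [m ^+ r] to [y ^+ r], while the signal loses [l] times that drop. *)
- rewrite yE [(_ < norm0 s')%N]ltnNge nm andbF; apply/negbTE; rewrite -leNgt.
  have X : y%:R ^+ r <= (norm0 s')%:R ^+ r :> R.
    by apply: lerXn2r; rewrite ?nnegrE ?ler_nat.
  have Y : p <= m%:R ^+ r - y%:R ^+ r :> R.
    by apply: exprB_ge => //; rewrite natr1 ler_nat.
  have H : b * p <= (l - gamma) * (m%:R ^+ r - y%:R ^+ r) by apply: ler_pM => //; lra.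
  have g0 : 0 <= gamma by lra.
  have := ler_wpM2l g0 X; lra.
Qed.

Definition step_coef s s' (a : midx r n) : R :=
  tpow r (vec s') a - tpow r (vec s) a.

Lemma dot_step_coef s s' W :
  \sum_a step_coef s s' a * W a =
  dot (tpow r (vec s')) W - dot (tpow r (vec s)) W.
Proof. by rewrite /dot -sumrB; apply: eq_bigr => a _; rewrite mulrBl. Qed.

(** In the factorization of a difference of powers, each of the [r] terms of the cofactor is at most
    [z ^+ r.-1]. *)
Lemma exprB_le (x y z : R) : 0 <= y -> y <= x -> x <= z ->
  x ^+ r - y ^+ r <= r%:R * (x - y) * z ^+ r.-1.
Proof.
case: r => [|q] y0 yx xz /=; first by rewrite !expr0 subrr !mul0r.
rewrite subrXX -mulrA mulrCA ler_wpM2l ?subr_ge0//.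
rewrite mulr_natl -[X in _ *+ X]card_ord -sumr_const ler_sum// => i _.
have x0 := le_trans y0 yx; have z0 := le_trans x0 xz.
rewrite -[in leRHS](subnK (n := q) (m := i)) ?exprD; last first.
  by rewrite -ltnS ltn_ord.
apply: ler_pM; rewrite ?exprn_ge0//.
  by apply: lerXn2r; rewrite ?nnegrE.
by apply: lerXn2r; rewrite ?nnegrE// (le_trans yx).
Qed.

End signal_plus_noise.

(** * Uniform control of the noise over all states and neighbours *)

Section noise_bound.
Context {R : realType} {r n : nat}.
Implicit Types s : config n.

(** This is the variance of one noise increment. By [dot_tpow] it is the sum of two differences of
    [r]-th powers, of each norm against the overlap, and [exprB_le] applies to both with [z] twice
    the norm of [s]. *)
Lemma step_coef_sqr_sum s s' : (0 < r)%N -> (2 <= norm0 s)%N ->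
    s' \in neighborhood s ->
  \sum_a step_coef (R := R) (r := r) s s' a ^+ 2
  <= (4 * r%:R * 2 ^+ r.-1) * (norm0 s)%:R ^+ r.-1.
Proof.
move=> r0 s2 Ns'; set m := norm0 s in s2 *; set x := norm0 s'.
have -> : \sum_a step_coef (r := r) s s' a ^+ 2 =
    (x%:R ^+ r - dot (vec s') (vec s) ^+ r) +
    (m%:R ^+ r - dot (vec s') (vec s) ^+ r) :> R.
  have E (t : config n) : (norm0 t)%:R ^+ r = dot (tpow r (vec t)) (tpow r (vec t)) :> R.
    by rewrite dot_tpow (dot_agrees (agrees_refl t)).
  rewrite /x /m !E -!dot_tpow /dot -!sumrB -big_split /=.
  by apply: eq_bigr => a _; rewrite /step_coef; ring.
(* The last bound is the squared Euclidean distance of [s] and [s'], which a sign flip brings to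
   4. *)
have [y0 [yx ym xm xy4]] : 0 <= dot (vec s') (vec s) :> R /\
   [/\ dot (vec s') (vec s) <= x%:R :> R, dot (vec s') (vec s) <= m%:R :> R,
       x%:R <= m%:R + 1 :> R &
       x%:R + m%:R - 2 * dot (vec s') (vec s) <= 4 :> R].
  rewrite {}/x; move: Ns' => /neighborhoodP[i [v [vi ->]]].
  rewrite dot_set_spin (dot_agrees (agrees_refl s)) -/m /vec.
  have := norm0_set_spin s i v; rewrite -/m.
  have vsi : ssval v != ssval (s i) by apply: contraNneq vi => /val_inj ->.
  move/(congr1 (fun k : nat => k%:R : R)); rewrite !natrD.
  have : 2 <= m%:R :> R by rewrite ler_nat.
  set x := (norm0 _)%:R; set mm := m%:R => mm2.
  by case: (spin_cases v) vsi => ->; case: (spin_cases (s i)) => -> //= _ E;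
    split; [lra|split; lra|lra|split; lra|lra|split; lra|lra|split; lra
           |lra|split; lra|lra|split; lra].
set y := dot _ _ in y0 yx ym xm xy4 *.
have m2 : 2 <= m%:R :> R by rewrite ler_nat.
have H1 := exprB_le (r := r) y0 yx (_ : x%:R <= 2 * m%:R).
have H2 := exprB_le (r := r) y0 ym (_ : m%:R <= 2 * m%:R).
apply: le_trans (lerD (H1 _) (H2 _)) _; [lra|lra|].
have p0 : 0 <= r%:R * (2 * m%:R) ^+ r.-1 :> R.
  by rewrite mulr_ge0// exprn_ge0// mulr_ge0.
have := ler_wpM2l p0 xy4; rewrite exprMn; lra.
Qed.

(** The weight factors over coordinates, where spin 0 contributes 1 and each other spin [q]. *)
Lemma sum_norm0 (q : R) : \sum_(s : config n) q ^+ norm0 s = (1 + 2 * q) ^+ n.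
Proof.
have cs : #|spin| = 3%N by rewrite card_seq_sub.
have zs : (0 : int) \in [:: -1; 0; 1] by [].
pose z : spin := SeqSub zs.
transitivity (\prod_(i < n) \sum_(v : spin) q ^+ (ssval v != 0)).
  rewrite bigA_distr_bigA; apply: eq_bigr => s _.
  by rewrite norm0_sum expr_sum.
rewrite prodr_const card_ord; congr (_ ^+ _).
rewrite (bigD1 z)//= expr0; congr (_ + _).
rewrite (eq_bigr (fun=> q)); last first.
  move=> v vz; case: eqP => // v0; case/eqP: vz.
  exact/val_inj.
rewrite sumr_const (cardC1 z) cs.
by rewrite mulr_natl.
Qed.

Definition step_noise {T : Type} (W : midx r n -> T -> R) s s' (w : T) : R :=
  dot (tpow r (vec s')) (W^~ w) - dot (tpow r (vec s)) (W^~ w).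

Definition large_noise_at {T : Type} (W : midx r n -> T -> R) b s s' : set T :=
  [set w | b * (norm0 s)%:R ^+ r.-1 <= `|step_noise W s s' w|].

Definition large_noise {T : Type} (W : midx r n -> T -> R) (b : R) : set T :=
  \big[setU/set0]_(s | (2 <= norm0 s)%N)
    \big[setU/set0]_(s' in neighborhood s) large_noise_at W b s s'.

Lemma large_noiseP {T : Type} (W : midx r n -> T -> R) b w :
  large_noise W b w <-> exists s s', [/\ (2 <= norm0 s)%N,
    s' \in neighborhood s & large_noise_at W b s s' w].
Proof.
rewrite /large_noise -bigcup_seq_cond; split.
  move=> -[s /= /andP[_ s2]].
  by rewrite -bigcup_seq_cond => -[s' /= /andP[_ Ns'] H]; exists s, s'.
move=> [s [s' [s2 Ns' H]]].
exists s; first by rewrite /= mem_index_enum.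
by rewrite -bigcup_seq_cond; exists s'; first rewrite /= mem_index_enum.
Qed.

Lemma measurable_step_noise {d} {T : measurableType d} (W : midx r n -> T -> R)
    s s' : (forall a, measurable_fun setT (W a)) ->
  measurable_fun setT (step_noise W s s').
Proof.
move=> mW; rewrite /step_noise; under eq_fun do rewrite -dot_step_coef.
exact: measurable_weighted_sum.
Qed.

Lemma measurable_large_noise_at {d} {T : measurableType d}
    (W : midx r n -> T -> R) b s s' : (forall a, measurable_fun setT (W a)) ->
  measurable (large_noise_at W b s s').
Proof.
move=> mW; rewrite -[X in measurable X]setTI; apply: measurable_fun_le => //.
by apply: measurableT_comp => //; exact: measurable_step_noise.
Qed.

(** The measurable structure is arbitrary, so that the lemma also applies to the sigma-algebra of a
    [history]. *)
Lemma measurable_large_noise {d} {T : measurableType d}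
    (W : midx r n -> T -> R) b : (forall a, measurable_fun setT (W a)) ->
  measurable (large_noise W b).
Proof.
move=> mW; apply: bigsetU_measurable => s _.
by apply: bigsetU_measurable => s' _; exact: measurable_large_noise_at.
Qed.

Context {d : measure_display} {T : measurableType d} (P : probability T R).

Lemma measure_bigsetU_le (K : Type) (A : K -> set T) (l : seq K) (Q : pred K) :
  (forall k, measurable (A k)) ->
  (P (\big[setU/set0]_(k <- l | Q k) A k) <= \sum_(k <- l | Q k) P (A k))%E.
Proof.
move=> mA; elim: l => [|k l IH]; first by rewrite !big_nil measure0.
rewrite !big_cons; case: ifP => // _.
apply: le_trans (measureU2 _ _ _) _; [exact: mA|exact: bigsetU_measurable|].
exact: leeD2l.
Qed.

Context (W : midx r n -> {RV P >-> R}).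
Hypothesis iidW : iid_std_normal W.

Let mW a : measurable_fun setT (W a). Proof. by []. Qed.

(** The variance constant of [step_coef_sqr_sum], plus 4 to leave a negative Chernoff exponent. *)
Let c : R := 4 * r%:R * 2 ^+ r.-1 + 4.

(** Chernoff with [t] equal to [L] or [- L]. The factor [n%:R ^- 4] pays for the choice of
    neighbour, and the power of [n%:R ^- 2] is the weight that makes the sum over states bounded. *)
Let large_noise_at_le s s' : (2 <= r)%N -> (0 < n)%N -> (2 <= norm0 s)%N ->
    s' \in neighborhood s ->
  (P (large_noise_at W (c * Num.sqrt (ln n%:R)) s s')
   <= (2 * (n%:R ^- 4) * (n%:R ^- 2) ^+ norm0 s)%:E)%E.
Proof.
move=> r2 n0 s2 Ns'; set L := Num.sqrt _.
have r0 : (0 < r)%N by lia.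
have v := step_coef_sqr_sum r0 s2 Ns'; set A := 4 * r%:R * _ in v *.
set m := norm0 s in s2 v *.
have ln0 : 0 <= ln n%:R :> R by rewrite ln_ge0// ler1n.
have L0 : 0 <= L by rewrite sqrtr_ge0.
have L2 : L ^+ 2 = ln n%:R by rewrite sqr_sqrtr.
have A0 : 0 <= A by rewrite !mulr_ge0// exprn_ge0.
pose b := L * (c * L * m%:R ^+ r.-1).
have n0R : n%:R != 0 :> R by rewrite pnatr_eq0; lia.
(* Here [r >= 2] enters: the exponent must be at least linear in [m] to beat the number of states of
   norm [m]. *)
have mp : m%:R <= m%:R ^+ r.-1 :> R.
  by apply: ler_eXnr; rewrite ?ler1n//; lia.
set p := m%:R ^+ r.-1 in b v mp *.
have bound : L ^+ 2 * (A * p) / 2 - b <= - (ln n%:R * (4 + 2 * m%:R)).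
  rewrite /b /c -/A.
  have -> : L * ((A + 4) * L * p) = L ^+ 2 * ((A + 4) * p) by ring.
  rewrite L2; have m2 : 2 <= m%:R :> R by rewrite ler_nat.
  have H : 4 + 2 * m%:R <= 4 * p by lra.
  have := ler_wpM2l ln0 H; have := mulr_ge0 ln0 (mulr_ge0 A0 (_ : 0 <= p)).
  have p0 : 0 <= p by lra.
  move=> /(_ p0); lra.
have tail t : t ^+ 2 = L ^+ 2 ->
    (P [set w | (b <= t * \sum_a step_coef s s' a * W a w)%R]
     <= (n%:R ^- 4 * (n%:R ^- 2) ^+ m)%:E)%E.
  move=> tL; apply: le_trans (gaussian_sum_tail iidW _ t b) _.
  rewrite lee_fin (_ : n%:R ^- 4 * _ = expR (- (ln n%:R * (4 + 2 * m%:R)))).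
    rewrite ler_expR tL; apply: le_trans bound; rewrite lerD2r.
    by rewrite ler_pM2r// ler_wpM2l// sqr_ge0.
  have -> : n%:R ^- 4 * (n%:R ^- 2) ^+ m = n%:R ^- (4 + 2 * m) :> R.
    by rewrite exprD exprM [RHS]invfM exprVn.
  by rewrite expRN -(natrM R 2) -natrD expRM_natr lnK// posrE ltr0n.
have mS t : measurable [set w | b <= t * \sum_a step_coef s s' a * W a w].
  rewrite -[X in measurable X]setTI; apply: measurable_fun_le => //.
  by apply: measurable_funM => //; exact: measurable_weighted_sum.
apply: (@le_trans _ _ (P ([set w | (b <= L * \sum_a step_coef s s' a * W a w)%R]
   `|` [set w | (b <= - L * \sum_a step_coef s s' a * W a w)%R]))).
  apply: le_measure; rewrite ?inE//;
    [exact: measurable_large_noise_at|exact: measurableU|].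
  move=> w; rewrite /large_noise_at /= /step_noise -dot_step_coef -/m -/p => H.
  set S := \sum_a _ in H *.
  have [S0|S0] := leP 0 S.
    by left; rewrite /b ler_wpM2l// -[S]ger0_norm.
  by right; rewrite /b mulNr -mulrN ler_wpM2l// -[- S]ltr0_norm.
apply: le_trans (measureU2 _ _ _) _ => //.
have := leeD (tail L erefl) (tail (- L) (sqrrN L)).
by move=> /le_trans; apply; rewrite -EFinD lee_fin; lra.
Qed.

(** Summing over the [2 * n] neighbours leaves [4 * n%:R ^- 3] times [q ^+ norm0 s], and by
    [sum_norm0] the states contribute [(1 + 2 * q) ^+ n], at most [expR (2 * q * n%:R)], where
    [q * n%:R <= 1]. *)
Lemma large_noise_le : (2 <= r)%N -> (0 < n)%N ->
  (P (large_noise W (c * Num.sqrt (ln n%:R))) <= (4 * expR 2 * n%:R ^- 3)%:E)%E.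
Proof.
move=> r2 n0; rewrite /large_noise; set b := c * _.
apply: le_trans (measure_bigsetU_le _ _ _) _ => [s|].
  by apply: bigsetU_measurable => s' _; exact: measurable_large_noise_at.
pose q : R := n%:R ^- 2.
have q0 : 0 <= q by rewrite invr_ge0 exprn_ge0.
have n4 : 0 <= n%:R ^- 4 :> R by rewrite invr_ge0 exprn_ge0.
apply: (@le_trans _ _ (\sum_(s : config n) ((4 * n%:R ^- 3) * q ^+ norm0 s)%:E)%E).
  rewrite big_mkcond; apply: lee_sum => s _; case: ifP => s2; last first.
    by rewrite lee_fin !mulr_ge0 ?exprn_ge0// invr_ge0 exprn_ge0.
  apply: le_trans (measure_bigsetU_le _ _ _) _.
    by move=> s'; exact: measurable_large_noise_at.
  apply: (@le_trans _ _ (\sum_(s' in neighborhood s)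
      (2 * (n%:R ^- 4) * q ^+ norm0 s)%:E)%E).
    by apply: lee_sum => s' Ns'; exact: large_noise_at_le.
  rewrite sumEFin sumr_const neighborhood_card lee_fin -[_ *+ (2 * n)]mulr_natl natrM.
  have n0R : n%:R != 0 :> R by rewrite pnatr_eq0; lia.
  rewrite le_eqVlt; apply/orP; left; apply/eqP; field.
  by rewrite n0R.
rewrite sumEFin -mulr_sumr sum_norm0 lee_fin.
rewrite -mulrA [expR 2 * _]mulrC mulrA ler_wpM2l ?mulr_ge0 ?invr_ge0 ?exprn_ge0//.
apply: (@le_trans _ _ (expR (2 * q) ^+ n)).
  by apply: lerXn2r; rewrite ?nnegrE ?expR_ge0 ?expR_ge1Dx// addr_ge0// mulr_ge0.
rewrite -expRM_natr ler_expR -mulrA ler_piMr// /q.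
have n1 : 1 <= n%:R :> R by rewrite ler1n.
rewrite mulrC ler_pdivrMr ?mul1r ?exprn_gt0 ?ltr0n//.
by rewrite expr2 ler_peMl.
Qed.

End noise_bound.

(** * Measurability through maps with finitely many values *)

Lemma measurable_fiberwise {d : measure_display} {T : measurableType d}
    {X : finType} (f : T -> X) (A : set T) :
    (forall x, measurable [set w | f w = x]) ->
    (forall w w', f w = f w' -> A w -> A w') -> measurable A.
Proof.
move=> mf fA; rewrite (_ : A = \big[setU/set0]_(x : X) (A `&` [set w | f w = x])).
  apply: bigsetU_measurable => x _.
  have [[w [Aw fw]]|nA] := pselect (exists w, A w /\ f w = x).
    rewrite setIidr// => w' /= fw'; apply: fA Aw; by rewrite fw fw'.
  rewrite (_ : _ `&` _ = set0)//; apply/seteqP; split => // w /= [Aw fw].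
  by apply: nA; exists w.
rewrite -bigcup_seq; apply/seteqP; split => [w Aw|w [x _ []]//].
by exists (f w) => //=; rewrite mem_index_enum.
Qed.

(** This finite table determines the greedy runs and, given the candidates, the randomized run, so
    [measurable_fiberwise] applies to events about them. *)
Lemma measurable_comparison_map {d : measure_display} {T : measurableType d}
    {R : realType} {X : finType} (H : T -> X -> R) :
    (forall x y, measurable [set w | H w x < H w y]) ->
  forall c : {ffun X * X -> bool},
  measurable [set w | [ffun p => H w p.1 < H w p.2] = c].
Proof.
move=> mH c; rewrite (_ : [set w | _] =
    \bigcap_(p in [set: X * X]) [set w | (H w p.1 < H w p.2) = c p]).
  apply: fin_bigcap_measurable; first exact: finite_finset.
  move=> [x y] _ /=; case: (c _); first exact: mH.
  rewrite (_ : [set w | _] = ~` [set w | H w x < H w y]).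
    exact/measurableC/mH.
  by apply/seteqP; split => w /=; [move=> ->|move/negP/negbTE].
apply/seteqP; split => w /=; first by move=> <- p _; rewrite /= ffunE.
by move=> Hw; apply/ffunP => p; rewrite ffunE Hw.
Qed.

(** * Randomized search: decay of the missing coordinates *)

Section randomized_search.
Context {R : realType} {r n : nat} {d : measure_display} {T : measurableType d}.
Context (P : probability T R) (W : midx r n -> {RV P >-> R}).

(** The event involves the noise alone, so it lies in every history and the draws stay uniform
    conditionally on it. *)
Lemma history_large_noiseC (cand : nat -> T -> config n) t b :
  history W cand t (~` large_noise W b).
Proof.
rewrite /history; set A := (X in <<s X >>).
apply: (@measurableC _ (g_sigma_algebraType A)).
apply: (@measurable_large_noise _ _ _ _ (g_sigma_algebraType A)) => a _ Y mY.
rewrite setTI; apply: sub_sigma_algebra; left; exists a, Y; by split.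
Qed.

Context (H : T -> config n -> R) (S0 theta : config n) (M : nat).
Context (cand : nat -> T -> config n) (G : set T).
Hypothesis mH : forall s s', measurable [set w | H w s < H w s'].
Hypothesis draws : uniform_draws W H S0 M cand.

Let state t w := rgls_state (H w) S0 (cand^~ w) t.

Lemma measurable_rgls_state t s : (t <= M)%N -> measurable [set w | state t w = s].
Proof.
elim: t s => [|t IH] s tM.
  have [->|sS0] := eqVneq s S0.
    by rewrite (_ : [set w | _] = setT)//; apply/seteqP; split.
  rewrite (_ : [set w | _] = set0)//; apply/seteqP; split => // w /= E.
  by rewrite -E eqxx in sS0.
pose f w := ([ffun p => H w p.1 < H w p.2] : {ffun config n * config n -> bool},
             (state t w, cand t w)).
apply: (@measurable_fiberwise _ _ _ f) => [[c [s1 s2]]|w w'].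
  rewrite (_ : [set w | _] = [set w | [ffun p => H w p.1 < H w p.2] = c] `&`
     ([set w | state t w = s1] `&` [set w | cand t w = s2])).
    apply: measurableI; first exact: measurable_comparison_map.
    by apply: measurableI; [exact/IH/ltnW|exact: (draws tM).1].
  apply/seteqP; split => w /= => [fw|[Ec [Es Ed]]]; last by rewrite /f Ec Es Ed.
  split; first exact: (congr1 fst fw).
  by split; [exact: (congr1 (fst \o snd) fw)|exact: (congr1 (snd \o snd) fw)].
move=> E; have /ffunP Ec := congr1 fst E.
have Es : state t w = state t w' := congr1 (fst \o snd) E.
have Ec' : cand t w = cand t w' := congr1 (snd \o snd) E.
 rewrite /= /state /= -/(state t w) -/(state t w') Es Ec'.
by have := Ec (state t w', cand t w'); rewrite !ffunE /= => ->.
Qed.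

Hypotheses (mG : measurable G) (histG : forall t, history W cand t G).
Hypothesis climb : forall w, G w -> climbing (H w) theta.
Hypotheses (S0th : agrees S0 theta) (S02 : (2 <= norm0 S0)%N).

Let good s : bool := agrees s theta && (2 <= norm0 s)%N.

(** The update rule freed from the random objective; on [G], from a good state with a neighbouring
    candidate, it is the actual update. *)
Let next s s' := if agrees s' theta && (norm0 s < norm0 s')%N then s' else s.

Let at_state t s : set T := G `&` [set w | state t w = s].

Let prob t s : R := fine (P (at_state t s)).

Let measurable_at_state t s : (t <= M)%N -> measurable (at_state t s).
Proof. by move=> tM; apply: measurableI => //; exact: measurable_rgls_state. Qed.

Let probE t s : (t <= M)%N -> P (at_state t s) = (prob t s)%:E.
Proof. by move=> tM; rewrite fineK// fin_num_measure//; exact: measurable_at_state. Qed.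

Let prob_ge0 t s : 0 <= prob t s. Proof. by rewrite fine_ge0. Qed.

Let n_gt0 : (0 < n)%N.
Proof.
have : (norm0 S0 <= n)%N by rewrite -[leqRHS]card_ord max_card.
exact/leq_trans/ltnW.
Qed.

Let draw_neighbor t s s' : (t < M)%N -> s' \in neighborhood s ->
  P (at_state t s `&` [set w | cand t w = s']) = ((2 * n)%:R^-1 * prob t s)%:E.
Proof.
move=> tM Ns'; have [_ /(_ G s s' (@histG t) Ns') /= E] := draws tM.
rewrite EFinM -probE; last exact: ltnW.
by rewrite [LHS]E neighborhood_card.
Qed.

Let measurable_draw t s (l : seq (config n)) : (t < M)%N ->
  measurable (at_state t s `&` [set w | cand t w \in l]).
Proof.
move=> tM; apply: measurableI; first exact/measurable_at_state/ltnW.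
apply: (@measurable_fiberwise _ _ _ (cand t)) => [x|w w' /= -> //].
exact: (draws tM).1.
Qed.

Let draw_in t s (l : seq (config n)) : (t < M)%N -> uniq l ->
    {subset l <= neighborhood s} ->
  P (at_state t s `&` [set w | cand t w \in l]) =
  ((size l)%:R * ((2 * n)%:R^-1 * prob t s))%:E.
Proof.
move=> tM; elim: l => [_ _|x l IH /= /andP[xl ul] lN].
  by rewrite mul0r (_ : _ `&` _ = set0) ?measure0//; apply/seteqP; split => // w [].
rewrite -natr1 mulrDl mul1r EFinD -IH//; last first.
  by move=> y yl; apply: lN; rewrite inE yl orbT.
have xN : x \in neighborhood s by apply: lN; rewrite mem_head.
rewrite -(draw_neighbor tM xN) -measureU//.
- congr (P _); apply/seteqP; split => w /=.
    move=> [Aw]; rewrite inE => /predU1P[cw|cl]; first by right.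
    by left.
  by move=> [[Aw cl]|[Aw cw]]; split => //; rewrite inE ?cl ?orbT// cw eqxx.
- exact: measurable_draw.
- apply: measurableI; [exact/measurable_at_state/ltnW|exact: (draws tM).1].
- apply/seteqP; split => // w /= [[_ cl] [_ cx]].
  by move: xl; rewrite -cx cl.
Qed.

(** The [2 * n] neighbours already exhaust the mass of [at_state t s]. *)
Let draw_other t s s' : (t < M)%N -> s' \notin neighborhood s ->
  P (at_state t s `&` [set w | cand t w = s']) = 0%E.
Proof.
move=> tM Ns'; set A := _ `&` _; pose l := enum (neighborhood s).
have mA : measurable A.
  by apply: measurableI; [exact/measurable_at_state/ltnW|exact: (draws tM).1].
have : (P A + P (at_state t s `&` [set w | cand t w \in l]) <= P (at_state t s))%E.
  rewrite -measureU//.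
  - apply: le_measure; rewrite ?inE.
    + by apply: measurableU => //; exact: measurable_draw.
    + exact/measurable_at_state/ltnW.
    + by move=> w [[]|[]].
  - exact: measurable_draw.
  - apply/seteqP; split => // w [[_ /= cw] [_ /=]].
    by rewrite mem_enum cw (negPf Ns').
rewrite draw_in ?enum_uniq//; last by move=> x; rewrite mem_enum.
rewrite -cardE neighborhood_card mulrA divff ?mul1r; last first.
  by rewrite pnatr_eq0 muln_eq0 /= -lt0n.
rewrite (probE _ (ltnW tM)) => le0; apply/eqP; rewrite eq_le measure_ge0 andbT.
by move: le0; rewrite -[X in (_ <= X)%E]add0e leeD2rE.
Qed.

Let state_next t w : G w -> good (state t w) -> cand t w \in neighborhood (state t w) ->
  state t.+1 w = next (state t w) (cand t w).
Proof.
move=> Gw /andP[ag n2] Nc; rewrite /state /= -/(state t w) /next.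
by rewrite (climb Gw).
Qed.

(** A forward inequality for the chain, from splitting by current state and candidate. The condition
    on bad states is a hypothesis because [prob_not_good] is itself proved by induction through this
    bound. *)
Let prob_next t z : (t < M)%N -> (forall s, ~~ good s -> prob t s = 0) ->
  prob t.+1 z <= \sum_(s | good s) \sum_(s' in neighborhood s)
    (next s s' == z)%:R * ((2 * n)%:R^-1 * prob t s).
Proof.
move=> tM prob0.
pose A s s' := at_state t s `&` [set w | cand t w = s'] `&` at_state t.+1 z.
have mA s s' : measurable (A s s').
  apply: measurableI; last exact: measurable_at_state.
  by apply: measurableI; [exact/measurable_at_state/ltnW|exact: (draws tM).1].
have mj s s' : measurable (at_state t s `&` [set w | cand t w = s']).
  by apply: measurableI; [exact/measurable_at_state/ltnW|exact: (draws tM).1].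
have AE : at_state t.+1 z = \big[setU/set0]_s \big[setU/set0]_s' A s s'.
  apply/seteqP; split => w; last first.
    by rewrite -bigcup_seq => -[s _]; rewrite -bigcup_seq => -[s' _ []].
  move=> [Gw zw]; rewrite -bigcup_seq; exists (state t w) => /=.
    by rewrite mem_index_enum.
  rewrite -bigcup_seq; exists (cand t w) => /=; first by rewrite mem_index_enum.
  by [].
rewrite -lee_fin -(probE _ tM) AE.
apply: le_trans (measure_bigsetU_le _ _ _ _) _ => [s|].
  exact: bigsetU_measurable.
rewrite -sumEFin big_mkcond [leRHS]big_mkcond/=.
apply: lee_sum => s _; case: ifPn => gs; last first.
  have -> : 0%E = (prob t s)%:E :> \bar R by rewrite prob0.
  rewrite -(probE _ (ltnW tM)); apply: le_measure; rewrite ?inE.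
  - exact: bigsetU_measurable.
  - exact/measurable_at_state/ltnW.
  - by move=> w; rewrite -bigcup_seq => -[s' _ [[]]].
apply: le_trans (measure_bigsetU_le _ _ _ _) _ => //.
rewrite -sumEFin [leRHS]big_mkcond/=.
apply: lee_sum => s' _; case: ifPn => Ns'; last first.
  rewrite -(draw_other tM Ns'); apply: le_measure; rewrite ?inE//.
  by move=> w [].
have [zE|zE] := eqVneq; last first.
  rewrite mul0r (_ : A s s' = set0) ?measure0//; apply/seteqP; split => // w /=.
  move=> [[[Gw sw] cw] [_ zw]]; case/eqP: zE; rewrite -zw state_next// ?sw ?cw//.
rewrite mul1r -(draw_neighbor tM Ns'); apply: le_measure; rewrite ?inE//.
by move=> w [].
Qed.

Let next_good s s' : good s -> good (next s s').
Proof.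
move=> /andP[ag n2]; rewrite /next /good; case: ifPn => [/andP[-> ns]|_].
  exact: leq_trans n2 (ltnW ns).
by rewrite ag.
Qed.

Let prob_not_good t s : (t <= M)%N -> ~~ good s -> prob t s = 0.
Proof.
elim: t s => [|t IH] s tM gs.
  rewrite /prob /at_state (_ : _ `&` _ = set0) ?measure0//.
  apply/seteqP; split => // w [_ /= E]; case/negP: gs.
  by rewrite -E /state /= /good S0th S02.
apply/eqP; rewrite eq_le prob_ge0 andbT.
apply: le_trans (prob_next _ tM _) _.
  by move=> x; apply: IH; exact: ltnW.
rewrite big1// => x gx; rewrite big1// => y _.
case: eqP => [xE|_]; last by rewrite mul0r.
by move: gs; rewrite -xE next_good.
Qed.

Let missing (i : 'I_n) (s : config n) : R := (ssval (s i) == 0)%:R.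

(** An accepted move increases the norm, so it never erases a coordinate. *)
Let next_missing i s s' : s' \in neighborhood s ->
  missing i (next s s') <= missing i s.
Proof.
move=> /neighborhoodP[j [v [vs ->]]]; rewrite /next; case: ifP => // /andP[_ ns].
have := norm0_set_spin s j v; rewrite /missing ffunE.
have [-> E|_ _] := eqVneq i j; last by [].
have [sj|sj] := eqVneq (ssval (s j)) 0; first by rewrite ler_nat leq_b1.
by move: E ns; rewrite sj; case: (ssval v != 0) => /=; lia.
Qed.

(** Among the [2 * n] neighbours, one fills coordinate [i] correctly and is accepted; the others
    create no gap. *)
Let sum_next_missing i s : good s -> ssval (theta i) != 0 ->
  \sum_(s' in neighborhood s) missing i (next s s')
  <= ((2 * n)%:R - 1) * missing i s.
Proof.
move=> /andP[ag n2] ti; have [si|si] := eqVneq (ssval (s i)) 0; last first.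
  have mi : missing i s = 0 by rewrite /missing (negPf si).
  by rewrite mi mulr0; apply: sumr_le0 => s' Ns'; rewrite -mi next_missing.
have mi : missing i s = 1 by rewrite /missing si eqxx.
have [Ns' ag' nE] := agrees_add_spin ag si ti.
rewrite mi mulr1 (bigD1 (set_spin s i (theta i)))//=.
rewrite {1}/missing /next ag' nE ltnS leqnn /= ffunE eqxx (negPf ti) add0r.
have -> : (2 * n)%:R = \sum_(s' in neighborhood s) 1 :> R.
  by rewrite sumr_const neighborhood_card.
rewrite [X in _ <= X - 1](bigD1 (set_spin s i (theta i)))//= addrAC subrr add0r.
by apply: ler_sum => s' /andP[Ns'' _]; rewrite -mi next_missing.
Qed.

Let rate : R := 1 - (2 * n)%:R^-1.

(** The mass of states missing [i] contracts by [rate] at each iteration: after exchanging sums, the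
    one over [z] collapses to [next s s'] and [sum_next_missing] applies. *)
Let sum_missing_prob i t : (t <= M)%N -> ssval (theta i) != 0 ->
  \sum_s missing i s * prob t s <= rate ^+ t.
Proof.
have m0 j s : 0 <= missing j s by [].
have n2 : (2 * n)%:R != 0 :> R by rewrite pnatr_eq0 muln_eq0 /= -lt0n.
have n2i : 0 <= (2 * n)%:R^-1 :> R by rewrite invr_ge0.
have rate0 : 0 <= rate.
  by rewrite subr_ge0 invf_le1 ?lt0r ?n2//= ler1n muln_gt0.
move=> + ti; elim: t => [_|t IH tM].
  rewrite expr0 (bigD1 S0)//= big1 ?addr0 => [|s sS0]; last first.
    rewrite /prob /at_state (_ : _ `&` _ = set0) ?measure0 ?mulr0//.
    by apply/seteqP; split => // w [_ /= E]; rewrite -E eqxx in sS0.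
  have p1 : prob 0 S0 <= 1.
    by rewrite -lee_fin -probE// probability_le1//; exact: measurable_at_state.
  by apply: mulr_ile1 => //; rewrite /missing; case: eqP.
apply: (@le_trans _ _ (\sum_z missing i z *
  \sum_(s | good s) \sum_(s' in neighborhood s)
    (next s s' == z)%:R * ((2 * n)%:R^-1 * prob t s))).
  apply: ler_sum => z _; apply: ler_wpM2l => //; apply: prob_next => //.
  by move=> s; apply: prob_not_good; exact: ltnW.
under eq_bigr do rewrite mulr_sumr.
rewrite exchange_big /=.
apply: (@le_trans _ _ (\sum_(s | good s) rate * (missing i s * prob t s))).
  apply: ler_sum => s gs; under eq_bigr do rewrite mulr_sumr.
  rewrite exchange_big /=.
  apply: (@le_trans _ _ ((\sum_(s' in neighborhood s) missing i (next s s'))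
      * ((2 * n)%:R^-1 * prob t s))).
    rewrite mulr_suml; apply: ler_sum => s' _.
    rewrite (bigD1 (next s s'))//= eqxx mul1r big1 ?addr0// => z /negPf zn.
    by rewrite eq_sym zn mul0r mulr0.
  apply: le_trans (ler_wpM2r _ (sum_next_missing gs ti)) _.
    by rewrite mulr_ge0.
  rewrite le_eqVlt; apply/orP; left; apply/eqP; rewrite /rate.
  by rewrite mulrACA mulrBl divff// mul1r.
rewrite -mulr_sumr exprS ler_wpM2l//; apply: le_trans (IH (ltnW tM)).
rewrite [leLHS]big_mkcond/=; apply: ler_sum => s _; case: ifP => // _.
by rewrite mulr_ge0.
Qed.

(** Union bound over the support of [theta]: a good state other than [theta] misses one of its
    coordinates. *)
Lemma rgls_not_theta_le :
  (P (G `&` [set w | state M w <> theta]) <= (n%:R * rate ^+ M)%:E)%E.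
Proof.
have AE : G `&` [set w | state M w <> theta] =
    \big[setU/set0]_(s | s != theta) at_state M s.
  rewrite -bigcup_seq_cond; apply/seteqP; split => w.
    move=> [Gw /= /eqP st]; exists (state M w) => //=.
    by rewrite mem_index_enum.
  by move=> [s /= /andP[_ st] [Gw /= sE]]; split => //= E; rewrite -sE E eqxx in st.
rewrite AE; apply: le_trans (measure_bigsetU_le _ _ _ _) _.
  by move=> s; exact: measurable_at_state.
apply: (@le_trans _ _ (\sum_(s : config n) \sum_(i < n | ssval (theta i) != 0%R)
    (missing i s * prob M s)%:E)%E).
  rewrite big_mkcond; apply: lee_sum => s _; rewrite sumEFin -mulr_suml.
  have S0' : 0 <= \sum_(i | ssval (theta i) != 0) missing i s by exact: sumr_ge0.
  case: ifP => st; last by rewrite lee_fin mulr_ge0.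
  rewrite probE// lee_fin; have [gs|gs] := boolP (good s); last first.
    by rewrite prob_not_good// mulr0.
  have [i si ti] := agrees_neq_ex (andP gs).1 st.
  rewrite ler_peMl// (bigD1 i)//= {1}/missing si eqxx lerDl.
  exact: sumr_ge0.
rewrite exchange_big /=.
apply: (@le_trans _ _ (\sum_(i < n | ssval (theta i) != 0%R) (rate ^+ M)%:E)%E).
  by apply: lee_sum => i ti; rewrite sumEFin lee_fin sum_missing_prob.
rewrite sumEFin lee_fin sumr_const -[leLHS]mulr_natl; apply: ler_wpM2r.
  rewrite exprn_ge0// /rate subr_ge0.
  by rewrite invf_le1 ?ltr0n ?ler1n ?muln_gt0.
by rewrite ler_nat -[leqRHS]card_ord max_card.
Qed.

End randomized_search.

(** * The success probability at fixed [n] *)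

Lemma local_search_success {R : realType} {r n M : nat} (k : nat)
    (Cgamma lambda : R) (theta S0 : config n) {d : measure_display}
    {T : measurableType d} (P : probability T R)
    (W : midx r n -> {RV P >-> R}) (cand : nat -> T -> config n) :
  let L := Num.sqrt (ln n%:R) in
  let c := 4 * r%:R * 2 ^+ r.-1 + 4 in
  let H w := objective (Cgamma * L)
    (observation lambda k theta (fun a => W a w)) in
  (2 <= r)%N -> c <= Cgamma ->
  (c + Cgamma) * L <= lambda / k%:R `^ (r%:R / 2) ->
  agrees S0 theta -> norm0 S0 = 2%N ->
  iid_std_normal W -> uniform_draws W H S0 M cand ->
  ((1 - (4 * expR 2 * n%:R ^- 3 + n%:R * (1 - (2 * n)%:R^-1) ^+ M))%:E <=
   P [set w |
       (forall (m : nat) (out : config n), greedy_output (H w) S0 m out <->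
          m = (norm0 theta - 2)%N /\ out = theta) /\
       rgls_state (H w) S0 (cand^~ w) M = theta])%E.
Proof.
move=> L c H r2 cC bgl S0th S02 iidW draws.
have mW a : measurable_fun setT (W a) by [].
have L0 : 0 <= L by rewrite sqrtr_ge0.
have c0 : 0 <= c by rewrite addr_ge0// !mulr_ge0// exprn_ge0.
have n0 : (0 < n)%N.
  have : (norm0 S0 <= n)%N by rewrite -[leqRHS]card_ord max_card.
  by rewrite S02; apply: leq_trans.
have mHs s : measurable_fun setT (fun w => H w s).
  rewrite /H; under eq_fun do rewrite objective_observation.
  by apply: measurable_funD => //; exact: measurable_weighted_sum.
have mH s s' : measurable [set w | H w s < H w s'].
  rewrite (_ : [set w | _] = ~` [set w | H w s' <= H w s]).
    apply: measurableC; rewrite -[X in measurable X]setTI.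
    exact: measurable_fun_le.
  by apply/seteqP; split => w /=; rewrite ltNge => /negP.
pose G := ~` large_noise W (c * L).
have mN : measurable (large_noise W (c * L)) by exact: measurable_large_noise.
have mG : measurable G by exact: measurableC.
have climb w : G w -> climbing (H w) theta.
  move=> Gw; apply: (@climbing_objective _ _ _ _ _ _ _ _ (c * L)).
  - exact: leq_trans r2.
  - exact: mulr_ge0.
  - exact: ler_wpM2r.
  - by rewrite -mulrDl.
  - move=> s s' s2 Ns'; rewrite ltNge; apply/negP => le_b.
    by apply: Gw; apply/large_noiseP; exists s, s'.
have S02' : (2 <= norm0 S0)%N by rewrite S02.
have histG t : history W cand t G by exact: history_large_noiseC.
have Rle := rgls_not_theta_le mH draws mG histG climb S0th S02'.
have Nle := large_noise_le iidW r2 n0.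
set E := [set w | _].
pose E1 := [set w | forall m out, greedy_output (H w) S0 m out <->
   m = (norm0 theta - 2)%N /\ out = theta].
pose E2 := [set w | rgls_state (H w) S0 (cand^~ w) M = theta].
have mE2 : measurable E2 by exact: (measurable_rgls_state mH draws).
have mE : measurable E.
  rewrite (_ : E = E1 `&` E2)//; apply: measurableI => //.
  (* The greedy event depends on the objective only through its comparison table, by
     [greedy_output_ext]. *)
  apply: (measurable_fiberwise (measurable_comparison_map mH)).
  move=> w w' /ffunP ww' E1w m out; rewrite -E1w.
  have ext s s' : (H w s < H w s') = (H w' s < H w' s').
    by have := ww' (s, s'); rewrite !ffunE.
  by split; apply: greedy_output_ext.
(* On [G] the greedy part holds surely, so failure means large noise or a late randomized search. *)
pose B := large_noise W (c * L) `|` (G `&` ~` E2).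
have mB : measurable B.
  by apply: measurableU => //; apply: measurableI => //; exact: measurableC.
have BE : ~` E `<=` B.
  move=> w nE; have [Gw|] := pselect (G w); last by move/contrapT; left.
  right; split => // E2w; apply: nE; split => // m out.
  by rewrite (greedy_climbing _ _ (climb _ Gw) S0th S02') S02.
rewrite -[E]setCK probability_setC; last exact: measurableC.
rewrite EFinB leeB//.
apply: (@le_trans _ _ (P B)).
  by apply: le_measure; rewrite ?inE//; exact: measurableC.
apply: le_trans (measureU2 _ _ _) _ => //.
  by apply: measurableI => //; exact: measurableC.
by rewrite EFinD; exact: leeD.
Qed.

(** * Number of iterations and the limit of large [n] *)

Section asymptotics.
Context {R : realType}.

(** The factor 6 turns survival at rate [1 / (2 * n)] per iteration into [n%:R ^- 3]; the successor
    compensates the truncation. *)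
Definition rgls_steps (n : nat) : nat :=
  (Num.truncn (6 * (n%:R * ln n%:R : R))).+1.

Lemma rgls_steps_Theta :
  (fun n => (rgls_steps n)%:R : R^o) =Theta_\oo (fun n => n%:R * ln n%:R : R^o).
Proof.
(* With [x = n%:R * ln n%:R], the count lies between [6 * x] and [6 * x + 1], which is at most
   [7 * x] once [x >= 1]. *)
rewrite eqThetaE qualifE; apply/asboolP; exists (1, 7); first by rewrite /= ltr01 ltr0n.
near=> n.
have ne : expR 1 <= n%:R :> R by near: n; exact: nbhs_infty_ger.
have n1 : 1 <= n%:R :> R by apply: le_trans ne; rewrite -[leLHS]expR0 ler_expR.
have n0 : 0 < n%:R :> R by lra.
have ln1 : 1 <= ln n%:R :> R by rewrite -[leLHS]expRK ler_ln// posrE expR_gt0.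
have x1 : 1 <= n%:R * ln n%:R :> R by apply: mulr_ege1.
have y0 : 0 <= n%:R * ln n%:R :> R by lra.
have -> : `|n%:R * ln n%:R : R^o| = n%:R * ln n%:R :> R by exact: ger0_norm.
have -> : `|(rgls_steps n)%:R : R^o| = (rgls_steps n)%:R :> R by exact: ger0_norm.
have x0 : 0 <= 6 * (n%:R * ln n%:R) :> R by lra.
have /andP[lo up] := Num.Theory.truncn_itv x0.
rewrite /= /rgls_steps; split; first by lra.
by move: lo up; rewrite -natr1; lra.
Unshelve. all: by end_near. Qed.

(** Each summand is at most [n%:R ^- 2], the second because [1 - x <= expR (- x)]; twice this is at
    most the inverse of [n], hence of its square root. *)
Lemma failure_bound (n : nat) : (2 <= n)%N -> 4 * expR 2 <= n%:R :> R ->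
  4 * expR 2 * n%:R ^- 3 + n%:R * (1 - (2 * n)%:R^-1) ^+ rgls_steps n
  <= (Num.sqrt n%:R)^-1 :> R.
Proof.
move=> n2 en.
have n2R : 2 <= n%:R :> R by rewrite ler_nat.
have n0 : 0 < n%:R :> R by lra.
have nz : n%:R != 0 :> R by rewrite gt_eqF.
have q0 : 0 < n%:R ^- 3 :> R by rewrite invr_gt0 exprn_gt0.
have first_le : 4 * expR 2 * n%:R ^- 3 <= n%:R * n%:R ^- 3 :> R.
  by apply: ler_wpM2r; [exact: ltW|exact: en].
have i2n : (2 * n)%:R^-1 <= 1 :> R.
  by rewrite invf_le1 ?ltr0n ?ler1n ?muln_gt0; lia.
have pow : (1 - (2 * n)%:R^-1) ^+ rgls_steps n <= n%:R ^- 3 :> R.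
  apply: (@le_trans _ _ (expR (- (2 * n)%:R^-1) ^+ rgls_steps n)).
    by apply: lerXn2r; rewrite ?nnegrE ?expR_ge0 ?subr_ge0// expR_ge1Dx.
  rewrite -expRM_natr -[n%:R ^- 3](lnK (x := n%:R ^- 3)) ?posrE// ler_expR.
  rewrite lnV ?posrE ?exprn_gt0// lnXn// mulNr lerN2 -[leLHS]mulr_natl.
  rewrite [leRHS]mulrC ler_pdivlMr ?ltr0n ?muln_gt0; last by lia.
  apply: le_trans (ltW (Num.Theory.truncnS_gt _)).
  by rewrite natrM; lra.
have : n%:R * (1 - (2 * n)%:R^-1) ^+ rgls_steps n <= n%:R * n%:R ^- 3 :> R.
  by rewrite ler_pM2l.
have E : n%:R * n%:R ^- 3 = (n%:R * n%:R)^-1 :> R by field.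
have sq : Num.sqrt n%:R <= n%:R :> R.
  apply: (@le_trans _ _ (Num.sqrt (n%:R ^+ 2))); last by rewrite sqrtr_sqr ger0_norm.
  by apply: ler_wsqrtr; rewrite expr2 ler_peMl//; lra.
have sq0 : 0 < Num.sqrt n%:R :> R by rewrite sqrtr_gt0.
have H : n%:R^-1 <= (Num.sqrt n%:R)^-1 :> R by rewrite lef_pV2 ?posrE.
have H2 : 2 * (n%:R * n%:R)^-1 <= n%:R^-1 :> R.
  rewrite invfM mulrA -[leRHS]mul1r ler_pM2r ?invr_gt0//.
  by rewrite ler_pdivrMr// mul1r.
move: first_le; rewrite E; lra.
Qed.

End asymptotics.

Unset Implicit Arguments.

Theorem theorem2p1 (R : realType) (r : nat) (hr : (2 <= r)%N) :
  exists2 Cgamma0 : R, 0 < Cgamma0 &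
  forall Cgamma : R, Cgamma0 <= Cgamma ->
  forall C : R, 0 < C ->
  exists2 M : nat -> nat,
    (fun n => (M n)%:R : R^o) =Theta_\oo (fun n => n%:R * ln n%:R : R^o) &
  forall (k : nat -> nat) (lambda : nat -> R),
    k n @[n --> \oo] --> \oo ->
    (forall n, (k n)%:R <= C * Num.sqrt n%:R) ->
    lambda n / ((k n)%:R `^ (r%:R / 2) * Num.sqrt (ln n%:R)) @[n --> \oo]
      --> +oo ->
  \forall n \near \oo,
  forall (theta S0 : config n),
    norm0 theta = k n ->
    norm0 S0 = 2%N ->
    dot (vec S0) (vec theta) = 2 :> R ->
  forall (d : measure_display) (T : measurableType d) (P : probability T R)
    (W : midx r n -> {RV P >-> R}) (cand : nat -> T -> config n),
    let gamma := Cgamma * Num.sqrt (ln n%:R) in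
    let Y w := observation (lambda n) (k n) theta (fun a => W a w) in
    let H w := objective gamma (Y w) in
    iid_std_normal W ->
    uniform_draws W H S0 (M n) cand ->
    ((1 - (Num.sqrt n%:R)^-1)%:E <=
     P [set w |
         (forall (m : nat) (out : config n),
            greedy_output (H w) S0 m out <-> m = (k n - 2)%N /\ out = theta) /\
         rgls_state (H w) S0 (cand^~ w) (M n) = theta])%E.
Proof.
pose c : R := 4 * r%:R * 2 ^+ r.-1 + 4.
have c0 : 0 < c by rewrite ltr_wpDl// !mulr_ge0// exprn_ge0.
exists c => // Cgamma cC C C0; exists (@rgls_steps R); first exact: rgls_steps_Theta.
(* The diverging ratio eventually exceeds [c + Cgamma], which is exactly the signal strength that
   [local_search_success] asks for. *)
move=> k lambda _ _ /cvgryPge /(_ (c + Cgamma)) snr.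
near=> n; move=> theta S0 tk S02 S0th d T P W cand iidW draws.
have n2 : (2 <= n)%N by near: n; exact: nbhs_infty_ge.
have en : 4 * expR 2 <= n%:R :> R by near: n; exact: nbhs_infty_ger.
have Kle : c + Cgamma <= lambda n / ((k n)%:R `^ (r%:R / 2) * Num.sqrt (ln n%:R)).
  by near: n.
have L0 : 0 < Num.sqrt (ln n%:R) :> R by rewrite sqrtr_gt0 ln_gt0// ltr1n.
have bgl : (c + Cgamma) * Num.sqrt (ln n%:R) <=
    lambda n / (k n)%:R `^ (r%:R / 2).
  by rewrite -ler_pdivlMr// -mulrA -invfM.
have ag : agrees S0 theta.
  by apply: (@dot_norm0_agrees _ R); rewrite S0th S02.
have H0 := local_search_success hr cC bgl ag S02 iidW draws.
rewrite tk in H0; apply: (le_trans _ H0).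
by rewrite lee_fin lerD2l lerN2; exact: failure_bound.
Unshelve. all: by end_near. Qed.
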